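(* Let $K$ be a perfect field, let $n\ge1$, and let $\mathbb{X}$ be a 0-dimensional scheme in $\mathbb{P}^n_K$ with support $\operatorname{Supp}(\mathbb{X})=\{p_1,\dots,p_s\}$, such that no point of the support lies on the hyperplane $X_0=0$. Let $I_{\mathbb{X}}\subseteq P=K[X_0,\dots,X_n]$ be its homogeneous vanishing ideal, and for $j\in\{1,\dots,s\}$ let $I_{p_j}$ be the homogeneous vanishing ideal of $\mathbb{X}$ at $p_j$ (the primary component of $I_{\mathbb{X}}$ at $p_j$). (a) The ideal $I_{\mathbb{X}}^{\mathrm{diff}}$ is a saturated homogeneous ideal of $P$, and $$I_{\mathbb{X}}^{\mathrm{diff}}=\{\,f\in I_{\mathbb{X}}\mid\partial_i f\in I_{\mathbb{X}}\text{ for all } i\in\{0,\dots,n\}\,\}\subseteq P.$$ (b) We have $I_{\mathbb{X}}^{\mathrm{diff}}=I_{p_1}^{\mathrm{diff}}\cap\cdots\cap I_{p_s}^{\mathrm{diff}}$, and $\sqrt{I_{p_j}^{\mathrm{diff}}}=\sqrt{I_{p_j}}$ for $j=1,\dots,s$.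
   Context: $P$ is standard graded and $\partial_i=\frac{\partial}{\partial X_i}$. $I_{\mathbb{X}}$ is the saturated homogeneous ideal of $P$ defining the 0-dimensional (closed sub)scheme $\mathbb{X}$; $\operatorname{Supp}(\mathbb{X})$ is the set of closed points of $\mathbb{X}$; the primary decomposition is $I_{\mathbb{X}}=I_{p_1}\cap\cdots\cap I_{p_s}$, where $I_{p_j}$ is the primary component whose radical is the homogeneous prime ideal of the closed point $p_j$. $K$-linear differential operators on $P$: $D_P^0=\operatorname{Hom}_P(P,P)$, and for $m\ge1$, $D_P^m=\{\delta\in\operatorname{Hom}_K(P,P)\mid \delta\circ\mu_f-\mu_f\circ\delta\in D_P^{m-1}\text{ for all } f\in P\}$, where $\mu_f$ is multiplication by $f$. For an ideal $I\subseteq P$, $I^{\mathrm{diff}}:=I^{\langle2\rangle}=\{f\in P\mid\delta(f)\in I\text{ for all }\delta\in D_P^1\}$. *)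

(* Defs.v *)
(* Ideals are Prop-valued subsets here: the ideals of ring_quotient.v are
   decidable and proper, which would be additional hypotheses. *)
From HB Require Import structures.
From mathcomp Require Import all_boot all_order all_algebra all_field.
From mathcomp Require Import boolp classical_sets.
From mathcomp Require Import mpoly.

Set Implicit Arguments.
Unset Strict Implicit.
Unset Printing Implicit Defensive.

Import GRing.Theory.
Local Open Scope ring_scope.
Local Open Scope classical_set_scope.

Definition perfect_field (K : fieldType) : Prop :=
  forall p : {poly K}, irreducible_poly p -> separable_poly p.

Section Ideals.
Variable A : comNzRingType.
Implicit Types I Q p : set A.

Definition is_ideal I : Prop :=
  [/\ I 0, forall f g, I f -> I g -> I (f + g)
    & forall a f, I f -> I (a * f)].

Definition radical I : set A := [set f | exists k : nat, I (f ^+ k)].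

Definition prime_ideal p : Prop :=
  [/\ is_ideal p, ~ p 1 & forall f g, p (f * g) -> p f \/ p g].

Definition primary_ideal Q : Prop :=
  [/\ is_ideal Q, ~ Q 1 & forall f g, Q (f * g) -> Q f \/ radical Q g].

(* Since the radicals p_j will be pairwise distinct closed points, without
   inclusions between them, such a decomposition is the unique irredundant one
   and Q j is the primary component of I at p j. *)
Definition primary_decomposition s I (p Q : 'I_s -> set A) : Prop :=
  [/\ forall j, primary_ideal (Q j), forall j, radical (Q j) = p j
    & I = \bigcap_(j in [set: 'I_s]) Q j].

End Ideals.

Section DifferentialOperators.
Variables (K : fieldType) (P : comAlgType K).

(* P^o is P as a module over itself: linearity there is P-linearity, whereas
   linearity on P is K-linearity. *)
Fixpoint diff_op (m : nat) (delta : P -> P) : Prop :=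
  match m with
  | 0%N => linear (delta : P^o -> P^o)
  | m'.+1 => linear delta /\
      forall f : P, diff_op m' (fun g => delta (f * g) - f * delta g)
  end.

(* Only meaningful for m >= 1. *)
Definition diff_power (m : nat) (I : set P) : set P :=
  [set f | forall delta, diff_op m.-1 delta -> I (delta f)].

Definition diff_ideal (I : set P) : set P := diff_power 2 I.

End DifferentialOperators.

Section ProjectiveSpace.
Variables (K : fieldType) (n : nat).
Local Notation P := {mpoly K[n.+1]}.
Implicit Types I p : set P.

Definition homogeneous_ideal I : Prop :=
  is_ideal I /\ forall f, I f -> forall d : nat, I (pihomog mdeg d f).

(* The k-th power of the irrelevant ideal (X_0, ..., X_n). *)
Definition irrelevant_power (k : nat) : set P :=
  [set g | forall m, m \in msupp g -> (k <= mdeg m)%N].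

Definition saturated I : Prop :=
  forall f, (exists k, forall g, irrelevant_power k g -> I (g * f)) -> I f.

(* Points of the scheme P^n_K = Proj P. *)
Definition proj_point p : Prop :=
  [/\ prime_ideal p, homogeneous_ideal p & ~ (irrelevant_power 1 `<=` p)].

(* Closed subschemes of P^n_K are represented by their saturated homogeneous
   vanishing ideals; the next definitions speak of the subscheme defined by I. *)
Definition subscheme_ideal I : Prop := homogeneous_ideal I /\ saturated I.

Definition point_of I p : Prop := proj_point p /\ I `<=` p.

Definition closed_point_of I p : Prop :=
  point_of I p /\ forall q, point_of I q -> p `<=` q -> q = p.

(* Irreducible closed subsets of a scheme are the closures of its points, so
   the chains of points below compute the dimension of the underlying space;
   in particular a subscheme of dimension 0 is nonempty. *)
Definition point_chain I (d : nat) (c : 'I_d.+1 -> set P) : Prop :=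
  (forall i, point_of I (c i)) /\ forall i j : 'I_d.+1, (i < j)%N -> c i `<` c j.

Definition has_dimension I (d : nat) : Prop :=
  (exists c : 'I_d.+1 -> set P, point_chain I c) /\
  (forall c : 'I_d.+2 -> set P, ~ point_chain I c).

Definition support_is s I (p : 'I_s -> set P) : Prop :=
  injective p /\ [set q | closed_point_of I q] = range p.

End ProjectiveSpace.

(* Main.v *)
(* A differential operator delta of order at most 1 is multiplication by
   delta(1) plus a K-derivation, and every K-derivation D of K[X_0, ..., X_n]
   is the sum of the D(X_i) d/dX_i. Hence I^diff consists of the f in I whose
   partial derivatives all lie in I, for every ideal I. The rest follows from
   the Leibniz rule: if g f lies in I^diff and f lies in I, then
   g df/dX_i lies in I, which gives saturation, and if f^k lies in I, then
   f^(2k) lies in I^diff, because its derivatives are multiples of f^k. *)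
Require Import Defs.
From HB Require Import structures.
From mathcomp Require Import all_boot all_order all_algebra all_field.
From mathcomp Require Import boolp classical_sets.
From mathcomp Require Import mpoly.
From mathcomp Require Import ring.

Set Implicit Arguments.
Unset Strict Implicit.
Unset Printing Implicit Defensive.

Import GRing.Theory.
Local Open Scope ring_scope.
Local Open Scope classical_set_scope.

Lemma linear_fun0 (R : nzRingType) (U V : lmodType R) (f : U -> V) :
  linear f -> f 0 = 0.
Proof.
move=> lin_f; have := lin_f 1 0 0; rewrite !scale1r !addr0 => /eqP.
by rewrite -subr_eq subrr => /eqP.
Qed.

Section FirstOrderOperators.
Variables (K : fieldType) (P : comAlgType K).

Lemma diff_op1_id : diff_op 1 (@id P).
Proof. by split=> // f a u v; rewrite !subrr scaler0 addr0. Qed.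

(** By the Leibniz rule the commutator of [D] with multiplication by [f] is multiplication by [D f],
    which is [P]-linear. *)
Lemma diff_op1_derivation (D : P -> P) :
  linear D -> (forall f g, D (f * g) = D f * g + f * D g) -> diff_op 1 D.
Proof.
move=> linD leibD; split=> // f a u v.
by rewrite !leibD !addrK mulrDr [in LHS]/GRing.scale /= mulrCA.
Qed.

(** The commutator of [delta] with multiplication by [f] is [P]-linear, hence multiplication by its
    value at 1, which is [delta f - f * delta 1]. *)
Lemma diff_op1_mul (delta : P -> P) : diff_op 1 delta ->
  forall f g, delta (f * g) = f * delta g + g * delta f - f * g * delta 1.
Proof.
move=> [lin_delta delta_comm] f g.
have := delta_comm f g 1 0.
rewrite /GRing.scale /= !addr0 !mulr1 !mulr0 (linear_fun0 lin_delta) mulr0 subr0 addr0.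
by move=> /eqP; rewrite subr_eq => /eqP ->; ring.
Qed.

(** Both sides quantify over all operators and all indices; only the order of the quantifiers
    differs. *)
Lemma diff_ideal_bigcap (J : Type) (Q : J -> set P) :
  diff_ideal (\bigcap_(j in [set: J]) Q j) =
  \bigcap_(j in [set: J]) diff_ideal (Q j).
Proof.
apply/seteqP; split=> f.
  by move=> diff_f j _ delta /diff_f; apply.
by move=> diff_f delta delta1 j _; apply: diff_f.
Qed.

End FirstOrderOperators.

Section Derivations.
Variables (K : fieldType) (n : nat).
Local Notation P := {mpoly K[n]}.

(** The difference [E] of the two sides is again a derivation and kills every variable, so it
    vanishes. *)
Lemma derivation_mpolyE (D : P -> P) :
    linear D -> (forall f g, D (f * g) = D f * g + f * D g) ->
  forall f, D f = \sum_i D 'X_i * f^`M(i).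
Proof.
move=> linD leibD.
pose E f := D f - \sum_i D 'X_i * f^`M(i).
have linE a u v : E (a *: u + v) = a *: E u + E v.
  rewrite /E linD scalerBr addrACA -opprD; congr (_ - _).
  rewrite scaler_sumr -big_split /=; apply: eq_bigr => i _.
  by rewrite linearP mulrDr scalerAr.
have leibE f g : E (f * g) = E f * g + f * E g.
  rewrite /E leibD mulrBl mulrBr addrACA -opprD; congr (_ - _).
  rewrite mulr_suml mulr_sumr -big_split /=; apply: eq_bigr => i _.
  by rewrite mderivM; ring.
have E0 : E 0 = 0 by exact: linear_fun0 linE.
have E1 : E 1 = 0.
  have := leibE 1 1; rewrite !mulr1 !mul1r => /eqP.
  by rewrite -subr_eq subrr => /eqP.
have EM f g : E f = 0 -> E g = 0 -> E (f * g) = 0.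
  by move=> Ef Eg; rewrite leibE Ef Eg mul0r mulr0 addr0.
have EX j : E 'X_j = 0.
  apply/eqP; rewrite subr_eq0 (bigD1 j) //= big1 => [|i neij].
    by rewrite mderivX mnm1E eqxx -[X in (X - _)%MM]add0m addmK mpolyX0 scale1r mulr1 addr0.
  by rewrite mderivX mnm1E eq_sym (negPf neij) scale0r mulr0.
suff Ez f : E f = 0 by move=> f; apply/eqP; rewrite -subr_eq0 -/(E f) Ez.
elim/mpolyind: f => // c m f _ _ Ef.
(* A monomial is a product of powers of variables, and the kernel of [E] contains 1 and the
   variables and is closed under products. *)
rewrite linE Ef addr0 mpolyXE_id; rewrite (_ : E _ = 0) ?scaler0 //.
apply: (big_ind (fun g => E g = 0)) => // i _.
by elim: (m i) => [|k IHk]; rewrite ?expr0 // exprS; apply: EM.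
Qed.

(** This carries homogeneity from [I] to [diff_ideal I]. By linearity it reduces to monomials; a
    component of degree 0 is constant, so its derivative is 0. *)
Lemma mderiv_pihomog (i : 'I_n) d (f : P) :
  (pihomog mdeg d f)^`M(i) =
  if d is d'.+1 then pihomog mdeg d' f^`M(i) else 0.
Proof.
elim/mpolyind: f => [|c m f _ _ IHf].
  by rewrite linear0 mderiv0; case: d => // d; rewrite linear0.
rewrite pihomog_is_linear mderivD mderivZ IHf {IHf} pihomogX.
(* Subtraction of multi-indices is truncated: [m - U_(i)] has degree one less only if [m i] is
   positive. Otherwise the coefficient [m i] makes the derivative vanish. *)
have [m0|m_gt0] := posnP (m i).
  have -> : (if mdeg m == d then 'X_[m] else 0 : P)^`M(i) = 0.
    by case: ifP; rewrite ?mderiv0 // mderivX m0 scale0r.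
  case: d => [|d]; rewrite scaler0 add0r //.
  by rewrite mderivD mderivZ mderivX m0 scale0r scaler0 add0r.
have def_m : mdeg m = (mdeg (m - U_(i))).+1.
  by rewrite -[m in LHS](@submK _ U_(i)) ?lep1mP -?lt0n // mdegD mdeg1 addn1.
case: d => [|d]; first by rewrite /= def_m mderiv0 scaler0 addr0.
rewrite /= def_m eqSS mderivD mderivZ mderivX pihomog_is_linear linearZ /= pihomogX.
by case: ifP; rewrite ?mderiv0 ?scaler0 // mderivX.
Qed.

End Derivations.

Section Ideals.
Variables (A : comNzRingType) (I : set A).
Hypothesis idI : is_ideal I.

Lemma ideal0 : I 0. Proof. by case: idI. Qed.

Lemma idealD f g : I f -> I g -> I (f + g).
Proof. by case: idI => _ + _; apply. Qed.

Lemma idealMl a f : I f -> I (a * f).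
Proof. by case: idI => _ _; apply. Qed.

Lemma idealB f g : I f -> I g -> I (f - g).
Proof. by move=> If Ig; rewrite -mulN1r; apply/idealD/idealMl. Qed.

Lemma ideal_sum (J : finType) (F : J -> A) : (forall j, I (F j)) -> I (\sum_j F j).
Proof. by move=> IF; apply: big_ind => //; [exact: ideal0|exact: idealD]. Qed.

End Ideals.

Section DiffIdeal.
Variables (K : fieldType) (n : nat).
Local Notation P := {mpoly K[n.+1]}.
Implicit Types I : set P.

Lemma diff_idealE I : is_ideal I ->
  diff_ideal I = [set f | I f /\ forall i : 'I_n.+1, I f^`M(i)].
Proof.
move=> idI; apply/seteqP; split=> f /=.
  move=> diff_f; split=> [|i]; first exact/(diff_f id)/diff_op1_id.
  apply/(diff_f (mderiv i))/diff_op1_derivation=> [a u v|u v].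
    exact: linearP.
  exact: mderivM.
move=> [If Idf] delta delta1; have [lin_delta _] := delta1.
have deltaM := diff_op1_mul delta1.
(* Removing the multiplication by [delta 1] leaves a derivation, so [delta f] is a combination of
   [f] and its partial derivatives. *)
pose D g := delta g - g * delta 1.
have DE : forall g, D g = \sum_i D 'X_i * g^`M(i).
  apply: derivation_mpolyE => [a u v|u v]; rewrite /D.
    by rewrite lin_delta mulrDl scalerBr -scalerAl opprD addrACA.
  by rewrite deltaM; ring.
rewrite -[delta f](subrK (f * delta 1)) -/(D f) DE [f * _]mulrC.
by apply: idealD => //; [apply: ideal_sum => // i|]; apply: idealMl.
Qed.

Lemma is_ideal_diff I : is_ideal I -> is_ideal (diff_ideal I).
Proof.
move=> idI; rewrite diff_idealE //.
split=> [|f g [If Idf] [Ig Idg]|a f [If Idf]].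
- by split=> [|i]; rewrite ?mderiv0; apply: ideal0.
- by split=> [|i]; rewrite ?mderivD; apply: idealD.
split=> [|i]; first exact: idealMl.
by rewrite mderivM; apply: idealD => //; apply: idealMl.
Qed.

Lemma homogeneous_diff_ideal I :
  homogeneous_ideal I -> homogeneous_ideal (diff_ideal I).
Proof.
move=> [idI homI]; split; first exact: is_ideal_diff.
rewrite diff_idealE // => f [If Idf] d; split=> [|i]; first exact: homI.
by rewrite mderiv_pihomog; case: d => [|d]; [apply: ideal0|apply: homI].
Qed.

Lemma saturated_diff_ideal I :
  is_ideal I -> saturated I -> saturated (diff_ideal I).
Proof.
move=> idI satI; rewrite diff_idealE // => f [k diff_f].
have If : I f by apply: satI; exists k => g /diff_f[].
split=> // i; apply: satI; exists k => g /diff_f[_ /(_ i)].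
(* The product of [g] with the derivative of [f] is the derivative of [g * f] minus a multiple of
   [f]; both lie in [I]. *)
rewrite mderivM => Idgf; rewrite -[g * _](addKr (g^`M(i) * f)) addrC.
by apply: idealB => //; apply: idealMl.
Qed.

Lemma radical_diff_ideal I : is_ideal I -> radical (diff_ideal I) = radical I.
Proof.
move=> idI; rewrite diff_idealE //; apply/seteqP; split=> f [k].
  by case=> Ifk _; exists k.
move=> Ifk; exists (k + k)%N; rewrite exprD; split=> [|i]; first exact: idealMl.
by rewrite mderivM; apply: idealD => //; [|rewrite mulrC]; apply: idealMl.
Qed.

End DiffIdeal.

Theorem proposition3p1 (K : fieldType) (n s : nat)
    (IX : set {mpoly K[n.+1]}) (p Ip : 'I_s -> set {mpoly K[n.+1]}) :
  perfect_field K -> (1 <= n)%N ->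
  subscheme_ideal IX -> has_dimension IX 0 ->
  support_is IX p ->
  (forall j, ~ p j 'X_(ord0 : 'I_n.+1)) ->
  primary_decomposition IX p Ip ->
  (* (a) *)
  ([/\ homogeneous_ideal (diff_ideal IX), saturated (diff_ideal IX)
     & diff_ideal IX = [set f | IX f /\ forall i : 'I_n.+1, IX f^`M(i)]]) /\
  (* (b) *)
  (diff_ideal IX = \bigcap_(j in [set: 'I_s]) diff_ideal (Ip j) /\
   forall j, radical (diff_ideal (Ip j)) = radical (Ip j)).
Proof.
move=> _ _ [homI satI] _ _ _ [primQ _ defI].
have idI := homI.1; have idQ j : is_ideal (Ip j) by case: (primQ j).
split.
  by split; [exact: homogeneous_diff_ideal|exact: saturated_diff_ideal|exact: diff_idealE].
by split=> [|j]; [rewrite defI diff_ideal_bigcap|exact: radical_diff_ideal].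
Qed.
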